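(* Let $G,H$ be graphs and let $\odot$ be an adjacency product. Then $$\bigcup_{k\in {\cal F}(G),\,k'\in {\cal F}(H)}{\cal F}(K_k\odot K_{k'})\subseteq \left(\bigcup_{k\in {\cal F}(H)}{\cal F}(G\odot K_k)\right)\cap\left(\bigcup_{k\in {\cal F}(G)}{\cal F}(K_k\odot H)\right),$$ and $$\left(\bigcup_{k\in {\cal F}(H)}{\cal F}(G\odot K_k)\right)\cup\left(\bigcup_{k\in {\cal F}(G)}{\cal F}(K_k\odot H)\right)\subseteq {\cal F}(G\odot H).$$
   Context: Graphs are finite, simple and nonempty; $K_n$ is the complete graph on $n$ vertices. For a proper coloring $f:V(G)\to\{1,\dots,k\}$, a vertex $v$ is a b-vertex if it has at least one neighbor in every color class $j\in\{1,\dots,k\}$, $j\neq f(v)$. A fall-coloring is a proper coloring in which every vertex is a b-vertex. ${\cal F}(G)$ (possibly empty) is the set of all $k$ for which $G$ has a fall-coloring with $k$ colors. An adjacency product $\odot$ assigns to graphs $G,H$ the simple graph $G\odot H$ on $V(G)\times V(H)$ in which $\alpha=(u_a,v_a)$ and $\beta=(u_b,v_b)$ are adjacent iff a condition $P_\odot(G,H,\alpha,\beta)$ holds, where $P_\odot$ is a fixed formula (the same for all $G,H$) built by conjunctions and disjunctions (no negations) from a subset of the four basic formulas $u_a=u_b$, $v_a=v_b$, $u_au_b\in E(G)$, $v_av_b\in E(H)$; since the product is a simple graph, $P_\odot(G,H,\alpha,\alpha)$ never holds. *)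

(* Defs.v *)
From mathcomp Require Import all_boot.
From mathcomp Require Import boolp classical_sets.

Set Implicit Arguments.
Unset Strict Implicit.
Unset Printing Implicit Defensive.

Local Open Scope classical_set_scope.

(* Finite simple graphs. The empty graph is allowed here, so that K_0 makes
   sense; nonemptiness is to be assumed explicitly. *)
Record sgraph := SGraph {
  vertex :> finType;
  edge : rel vertex;
  edge_sym : symmetric edge;
  edge_irrefl : irreflexive edge
}.

Definition complete_edge (n : nat) : rel 'I_n := fun u v => u != v.

Lemma complete_edge_sym (n : nat) : symmetric (@complete_edge n).
Proof. by move=> u v; rewrite /complete_edge eq_sym. Qed.

Lemma complete_edge_irrefl (n : nat) : irreflexive (@complete_edge n).
Proof. by move=> u; rewrite /complete_edge eqxx. Qed.

Definition complete_graph (n : nat) : sgraph :=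
  SGraph (@complete_edge_sym n) (@complete_edge_irrefl n).

Section FallColoring.
Variables (G : sgraph) (k : nat) (f : G -> 'I_k).

Definition proper_coloring : Prop :=
  forall u v : G, edge u v -> f u <> f v.

Definition b_vertex (v : G) : Prop :=
  forall j : 'I_k, j <> f v -> exists2 w : G, edge v w & f w = j.

Definition fall_coloring : Prop :=
  proper_coloring /\ forall v : G, b_vertex v.

End FallColoring.

(* On a nonempty graph, a fall-coloring with values in 'I_k automatically uses
   all k colors. *)
Definition fall_set (G : sgraph) : set nat :=
  [set k | exists f : G -> 'I_k, fall_coloring f].

(* Negation-free formulas over the four atoms
   u_a = u_b, v_a = v_b, u_a u_b \in E(G), v_a v_b \in E(H). *)
Inductive adj_formula : Type :=
  | EqL
  | EqR
  | AdjL
  | AdjR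
  | And of adj_formula & adj_formula
  | Or of adj_formula & adj_formula.

Fixpoint holds (P : adj_formula) (G H : sgraph) (a b : G * H) : bool :=
  match P with
  | EqL => a.1 == b.1
  | EqR => a.2 == b.2
  | AdjL => edge a.1 b.1
  | AdjR => edge a.2 b.2
  | And P1 P2 => holds P1 a b && holds P2 a b
  | Or P1 P2 => holds P1 a b || holds P2 a b
  end.

Lemma holds_sym (P : adj_formula) (G H : sgraph) :
  symmetric (@holds P G H).
Proof.
move=> a b; elim: P => [||||P1 IH1 P2 IH2|P1 IH1 P2 IH2] /=.
- exact: eq_sym.
- exact: eq_sym.
- exact: edge_sym.
- exact: edge_sym.
- by rewrite IH1 IH2.
- by rewrite IH1 IH2.
Qed.

(* The formula is fixed once and for all, independently of G and H. *)
Record adjacency_product := AdjacencyProduct {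
  formula : adj_formula;
  formula_irrefl : forall G H : sgraph, irreflexive (@holds formula G H)
}.

Definition adj_prod (op : adjacency_product) (G H : sgraph) : sgraph :=
  @SGraph (G * H)%type (@holds (formula op) G H)
    (@holds_sym (formula op) G H) (@formula_irrefl op G H).

(* Main.v *)
Require Import Defs.
From mathcomp Require Import all_boot.
From mathcomp Require Import boolp classical_sets.

Local Open Scope classical_set_scope.

(** A fall-coloring of [G] with [k] colors is the same thing as a homomorphism
    [G -> K_k] along which every vertex of [K_k] can be reached from every
    vertex [u] of [G]: color [f u] by [u] itself and any other color by a
    neighbor of [u].  Hence both atoms, equality and adjacency, are preserved
    by [f] and can be lifted along it, which is the notion of [fibration] below.
    As the formula of an adjacency product has no negations, its truth can be
    carried along a pair of fibrations and lifted back, so the product of two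
    fibrations is again a fibration ([fibration_prod]).  Finally, fall-colorings
    pull back along fibrations ([fall_set_fibration]).  Each of the four
    inclusions of the theorem is an instance of this, for the product of
    a fall-coloring of one factor with the identity of the other. *)

(** The lift is requested for every target vertex [c], not only for those equal
    or adjacent to [phi u]: a formula such as the single atom [AdjR] joins pairs
    whose first coordinates are unrelated.  A single [u'] has to serve both
    atoms, because a formula may mention both of them. *)
Definition fibration {G G' : sgraph} (phi : G -> G') : Prop :=
  (forall u v : G, edge u v -> edge (phi u) (phi v)) /\
  forall (u : G) (c : G'), exists u' : G,
    [/\ phi u' = c, phi u = c -> u = u' & edge (phi u) c -> edge u u'].

Lemma fibration_id (G : sgraph) : @fibration G G id.
Proof. by split=> // u c; exists c. Qed.

(** In [K_k] any two vertices are either equal or adjacent; the lift of a color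
    [c] is [u] in the first case, and in the second case the neighbor provided
    by the fact that [u] is a b-vertex. *)
Lemma fibration_fall_coloring {G : sgraph} {k : nat} {f : G -> 'I_k} :
  fall_coloring f -> @fibration G (complete_graph k) f.
Proof.
move=> [f_proper f_b]; split=> [u v uv | u c].
  by apply/eqP; exact: f_proper.
have [-> | c_neq] := eqVneq c (f u).
  by exists u; split=> //; rewrite (@edge_irrefl (complete_graph k)).
have [w uw fw] := f_b u c (elimN eqP c_neq).
by exists w; split=> // fu; rewrite fu eqxx in c_neq.
Qed.

Lemma fibration_prod (op : adjacency_product) {G G' H H' : sgraph}
    {phi : G -> G'} {psi : H -> H'} :
  fibration phi -> fibration psi ->
  @fibration (adj_prod op G H) (adj_prod op G' H')
    (fun a => (phi a.1, psi a.2)).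
Proof.
move=> [phi_hom phi_lift] [psi_hom psi_lift]; split=> [a b | a [c d]] /=.
  elim: (formula op) => [||||P IHP Q IHQ|P IHP Q IHQ] /=.
  - by move/eqP->.
  - by move/eqP->.
  - exact: phi_hom.
  - exact: psi_hom.
  - by case/andP=> /IHP-> /IHQ->.
  - by case/orP=> [/IHP->|/IHQ->]; rewrite ?orbT.
have [u [phi_u eq_u adj_u]] := phi_lift a.1 c.
have [v [psi_v eq_v adj_v]] := psi_lift a.2 d.
exists (u, v); split=> /=; first by rewrite phi_u psi_v.
  by case: a eq_u eq_v {adj_u adj_v} => x y /= eq_u eq_v [/eq_u-> /eq_v->].
elim: (formula op) => [||||P IHP Q IHQ|P IHP Q IHQ] /=.
- by move/eqP/eq_u->.
- by move/eqP/eq_v->.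
- exact: adj_u.
- exact: adj_v.
- by case/andP=> /IHP-> /IHQ->.
- by case/orP=> [/IHP->|/IHQ->]; rewrite ?orbT.
Qed.

(** Composing with a homomorphism keeps a coloring proper, and a neighbor of
    [phi u] with a prescribed color lifts to a neighbor of [u]. *)
Lemma fall_set_fibration {G G' : sgraph} {phi : G -> G'} :
  fibration phi -> fall_set G' `<=` fall_set G.
Proof.
move=> [phi_hom phi_lift] k [f [f_proper f_b]]; exists (f \o phi); split.
  by move=> u v /phi_hom; exact: f_proper.
move=> u j /(f_b (phi u))[c uc fc].
have [u' [phi_u' _ /(_ uc) uu']] := phi_lift u c.
by exists u'; rewrite //= phi_u'.
Qed.

Lemma fall_set_adj_prodl {op : adjacency_product} {G H : sgraph} {k : nat} :
  fall_set G k ->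
  fall_set (adj_prod op (complete_graph k) H) `<=` fall_set (adj_prod op G H).
Proof.
move=> [f /fibration_fall_coloring f_fib].
exact: fall_set_fibration (fibration_prod op f_fib (fibration_id H)).
Qed.

Lemma fall_set_adj_prodr {op : adjacency_product} {G H : sgraph} {k : nat} :
  fall_set H k ->
  fall_set (adj_prod op G (complete_graph k)) `<=` fall_set (adj_prod op G H).
Proof.
move=> [f /fibration_fall_coloring f_fib].
exact: fall_set_fibration (fibration_prod op (fibration_id G) f_fib).
Qed.

Theorem corollary5 (op : adjacency_product) (G H : sgraph)
    (G_nonempty : 0 < #|G|) (H_nonempty : 0 < #|H|) :
  (\bigcup_(k in fall_set G) \bigcup_(k' in fall_set H)
      fall_set (adj_prod op (complete_graph k) (complete_graph k'))
   `<=`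
   (\bigcup_(k in fall_set H) fall_set (adj_prod op G (complete_graph k)))
   `&`
   (\bigcup_(k in fall_set G) fall_set (adj_prod op (complete_graph k) H)))
  /\
  ((\bigcup_(k in fall_set H) fall_set (adj_prod op G (complete_graph k)))
   `|`
   (\bigcup_(k in fall_set G) fall_set (adj_prod op (complete_graph k) H))
   `<=`
   fall_set (adj_prod op G H)).
Proof.
split=> [n [k Gk [k' Hk' n_fall]] | n [[k Hk n_fall] | [k Gk n_fall]]].
- split; first by exists k' => //; exact: fall_set_adj_prodl n_fall.
  by exists k => //; exact: fall_set_adj_prodr n_fall.
- exact: fall_set_adj_prodr n_fall.
- exact: fall_set_adj_prodl n_fall.
Qed.
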